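(* Let $p$ be a prime, $n\geq 3$ an integer, and $A$ the ring defined in the context. A homomorphic image $R$ of $A$ is minimal noncommutative if and only if it can be obtained as the output $R_N$ of the iterative procedure described in the context, for some sequence of choices made in the procedure.
   Context: All rings are associative with $1$, and subrings contain the identity element. A ring is minimal noncommutative if it is not commutative but all its proper subrings and all its proper homomorphic images (quotients by nonzero two-sided ideals) are commutative. Let $\mathbb{Z}\langle x,y\rangle$ be the free associative ring on $x,y$, $[x,y]=xy-yx$, $(p,x,y)$ the two-sided ideal generated by $p,x,y$, and $A=\mathbb{Z}\langle x,y\rangle/(I+(p,x,y)^n)$ where $I=(p,x,y)[x,y]\mathbb{Z}\langle x,y\rangle+\mathbb{Z}\langle x,y\rangle[x,y](p,x,y)$. A homomorphic image of $A$ is a quotient of $A$ by a two-sided ideal; images of $x,y$ in it are denoted by the same letters, and $(p,x,y)$ denotes the ideal generated by $p,x,y$ there. $F_p$ is the field with $p$ elements, and $F_p[x,y]$ denotes the set of multiples $m[x,y]$ of the commutator (not a polynomial ring); note $p[x,y]=0$. Iterative procedure. Start with $R_0=A$. Given $R_i$, let $A_i$ be the set of elements $r\in R_i$ such that $r(p,x,y)=0$ and $(p,x,y)r=0$; this is an $F_p$-vector space containing $[x,y]$. If $A_i=F_p[x,y]$ the procedure stops, and, with $N=i$, its output is $R_N$. Otherwise: (a) extend $\{[x,y]\}$ to a basis $\{[x,y]\}\sqcup V_i$ of the $F_p$-vector space $A_i$; (b) for each $v\in V_i$ pick a scalar $m_v\in F_p$ and let $I_i$ be the ideal of $R_i$ generated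 by the elements $v-m_v[x,y]$, $v\in V_i$; (c) set $R_{i+1}=R_i/I_i$ and repeat. Since $A$ is finite, the procedure stops after finitely many steps. The choices are the sets $V_i$ and the scalars $m_v$. *)

(* Defs.v *)
From HB Require Import structures.
From mathcomp Require Import all_boot all_algebra finmap.
From mathcomp Require Import generic_quotient ring_quotient.
From mathcomp Require Import boolp classical_sets.
From mathcomp.multinomials Require Import monalg.

Set Implicit Arguments.
Unset Strict Implicit.
Unset Printing Implicit Defensive.

Import GRing.Theory.

Local Open Scope classical_set_scope.
Local Open Scope ring_scope.
Local Open Scope quotient_scope.

(* [ring_quotient] only has quotients of commutative nontrivial rings; here the
   rings are arbitrary and the unit ideal is allowed (the quotient is then the
   zero ring). The additive quotient is the one of the library. *)
HB.mixin Record isTwoSided (R : pzRingType) (S : R -> bool) := {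
  ideal_mull_subproof : forall a u, u \in S -> a * u \in S;
  ideal_mulr_subproof : forall a u, u \in S -> u * a \in S
}.

#[short(type="ideal")]
HB.structure Definition TwoSidedIdeal (R : pzRingType) :=
  {S of GRing.ZmodClosed R S & isTwoSided R S}.

Lemma ideal_mull (R : pzRingType) (J : ideal R) (a u : R) :
  u \in J -> a * u \in J.
Proof. exact: ideal_mull_subproof. Qed.

Lemma ideal_mulr (R : pzRingType) (J : ideal R) (a u : R) :
  u \in J -> u * a \in J.
Proof. exact: ideal_mulr_subproof. Qed.

Section QuotientRing.
Variables (R : pzRingType) (J : ideal R).

Definition quot_ring := Quotient.quot J.
HB.instance Definition _ := GRing.Zmodule.on quot_ring.

Definition quot_proj (r : R) : quot_ring := \pi_(Quotient.quot J) r.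

Definition quot_one : quot_ring := quot_proj 1.
Definition quot_mul (u v : quot_ring) : quot_ring :=
  quot_proj (repr (u : Quotient.quot J) * repr (v : Quotient.quot J)).

Lemma quot_proj_eqP (r s : R) : quot_proj r = quot_proj s <-> r - s \in J.
Proof.
rewrite Quotient.idealrBE; split=> [E|/eqP //].
by apply/eqP; exact: E.
Qed.

Lemma quot_projK (u : quot_ring) :
  quot_proj (repr (u : Quotient.quot J)) = u.
Proof. exact: reprK. Qed.

Lemma quot_proj_zmod_morphism : zmod_morphism quot_proj.
Proof. by move=> r s; rewrite /quot_proj raddfB. Qed.

HB.instance Definition _ :=
  GRing.isZmodMorphism.Build R quot_ring quot_proj quot_proj_zmod_morphism.

Lemma quot_projM (r s : R) :
  quot_proj (r * s) = quot_mul (quot_proj r) (quot_proj s).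
Proof.
rewrite /quot_mul; set r' := repr _; set s' := repr _.
have hr : r - r' \in J by apply/quot_proj_eqP; rewrite quot_projK.
have hs : s - s' \in J by apply/quot_proj_eqP; rewrite quot_projK.
apply/quot_proj_eqP.
have -> : r * s - r' * s' = (r - r') * s + r' * (s - s').
  by rewrite mulrBl mulrBr addrA subrK.
by apply: rpredD; [exact: ideal_mulr | exact: ideal_mull].
Qed.

Lemma quot_mulA : associative quot_mul.
Proof.
move=> u v w; rewrite -(quot_projK u) -(quot_projK v) -(quot_projK w).
by rewrite -!quot_projM mulrA.
Qed.

Lemma quot_mul1l : left_id quot_one quot_mul.
Proof. by move=> u; rewrite -(quot_projK u) -quot_projM mul1r. Qed.

Lemma quot_mul1r : right_id quot_one quot_mul.
Proof. by move=> u; rewrite -(quot_projK u) -quot_projM mulr1. Qed.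

Lemma quot_mulDl : left_distributive quot_mul +%R.
Proof.
move=> u v w; rewrite -(quot_projK u) -(quot_projK v) -(quot_projK w).
by rewrite -raddfD -!quot_projM -raddfD mulrDl.
Qed.

Lemma quot_mulDr : right_distributive quot_mul +%R.
Proof.
move=> u v w; rewrite -(quot_projK u) -(quot_projK v) -(quot_projK w).
by rewrite -raddfD -!quot_projM -raddfD mulrDr.
Qed.

HB.instance Definition _ := GRing.Zmodule_isPzRing.Build quot_ring
  quot_mulA quot_mul1l quot_mul1r quot_mulDl quot_mulDr.

Lemma quot_proj_monoid_morphism : monoid_morphism quot_proj.
Proof. by split=> // r s; exact: quot_projM. Qed.

HB.instance Definition _ :=
  GRing.isMonoidMorphism.Build R quot_ring quot_proj quot_proj_monoid_morphism.

End QuotientRing.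

Section IdealOfSet.
Variable R : pzRingType.

Definition is_ideal (X : set R) : Prop :=
  [/\ X 0, forall u v, X u -> X v -> X (u + v),
      forall a u, X u -> X (a * u) & forall a u, X u -> X (u * a)].

Definition ideal_pred (X : set R) (hX : is_ideal X) : R -> bool :=
  fun r => `[< X r >].

Variables (X : set R) (hX : is_ideal X).

Lemma ideal_pred_zmod_closed : zmod_closed (ideal_pred hX).
Proof.
have [X0 XD XM _] := hX; split; first exact/asboolP.
move=> u v /asboolP Xu /asboolP Xv; apply/asboolP/XD => //.
by rewrite -mulN1r; exact: XM.
Qed.

HB.instance Definition _ :=
  GRing.isZmodClosed.Build R (ideal_pred hX) ideal_pred_zmod_closed.

Lemma ideal_pred_mull a u : u \in ideal_pred hX -> a * u \in ideal_pred hX.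
Proof. by have [_ _ XM _] := hX; move=> /asboolP Xu; apply/asboolP/XM. Qed.

Lemma ideal_pred_mulr a u : u \in ideal_pred hX -> u * a \in ideal_pred hX.
Proof. by have [_ _ _ XM] := hX; move=> /asboolP Xu; apply/asboolP/XM. Qed.

HB.instance Definition _ :=
  isTwoSided.Build R (ideal_pred hX) ideal_pred_mull ideal_pred_mulr.

Definition ideal_of_set : ideal R :=
  TwoSidedIdeal.clone R (ideal_pred hX) _.

End IdealOfSet.

Section GeneratedIdeal.
Variables (R : pzRingType) (X : set R).

Definition gen_ideal_set : set R :=
  [set r | forall J : ideal R, (forall u, X u -> u \in J) -> r \in J].

Lemma gen_ideal_set_is_ideal : is_ideal gen_ideal_set.
Proof.
split=> [J _|u v hu hv J hJ|a u hu J hJ|a u hu J hJ]; first exact: rpred0.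
- by apply: rpredD; [exact: hu | exact: hv].
- by apply: ideal_mull; exact: hu.
- by apply: ideal_mulr; exact: hu.
Qed.

Definition gen_ideal : ideal R := ideal_of_set gen_ideal_set_is_ideal.

End GeneratedIdeal.

Definition commutative_ring (R : pzRingType) : Prop :=
  commutative (@GRing.mul R).

(* Subsets are boolean predicates, which classically (boolp) loses nothing. *)
Definition minimal_noncommutative (R : pzRingType) : Prop :=
  [/\ ~ commutative_ring R,
      forall S : {pred R}, subring_closed S -> (exists r, r \notin S) ->
        {in S &, commutative (@GRing.mul R)}
    & forall J : ideal R, (exists2 r, r \in J & r != 0) ->
        commutative_ring (quot_ring J)].

Section ProductsOfSubsets.
Variable R : pzRingType.
Implicit Types X Y : set R.

(* Product of subsets as of ideals: all finite sums of products. *)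
Definition mul_span X Y : set R :=
  [set r | exists2 s : seq (R * R),
     (forall u, u \in s -> X u.1 /\ Y u.2) & r = \sum_(u <- s) u.1 * u.2].

Definition sum_set X Y : set R :=
  [set r | exists a b, [/\ X a, Y b & r = a + b]].

Definition pow_span X (n : nat) : set R := iter n (mul_span X) setT.

Lemma mul_span_is_ideal X Y :
  (forall a u, X u -> X (a * u)) -> (forall a u, Y u -> Y (u * a)) ->
  is_ideal (mul_span X Y).
Proof.
move=> hX hY; split.
- by exists [::] => //; rewrite big_nil.
- move=> _ _ [s hs ->] [t ht ->]; exists (s ++ t); last by rewrite big_cat.
  by move=> u; rewrite mem_cat => /orP[/hs|/ht].
- move=> a _ [s hs ->]; exists [seq (a * u.1, u.2) | u <- s].
    by move=> _ /mapP[u /hs[Xu Yu] ->]; split => //=; exact: hX.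
  by rewrite big_map mulr_sumr; apply: eq_bigr => u _; rewrite mulrA.
- move=> a _ [s hs ->]; exists [seq (u.1, u.2 * a) | u <- s].
    by move=> _ /mapP[u /hs[Xu Yu] ->]; split => //=; exact: hY.
  by rewrite big_map mulr_suml; apply: eq_bigr => u _; rewrite mulrA.
Qed.

Lemma mul_span_mull X Y a u :
  (forall b v, X v -> X (b * v)) -> mul_span X Y u -> mul_span X Y (a * u).
Proof.
move=> hX [s hs ->]; exists [seq (a * v.1, v.2) | v <- s].
  by move=> _ /mapP[v /hs[Xv Yv] ->]; split => //=; exact: hX.
by rewrite big_map mulr_sumr; apply: eq_bigr => v _; rewrite mulrA.
Qed.

Lemma sum_set_is_ideal X Y :
  is_ideal X -> is_ideal Y -> is_ideal (sum_set X Y).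
Proof.
move=> [X0 XD XL XR] [Y0 YD YL YR]; split.
- by exists 0, 0; rewrite addr0.
- move=> _ _ [a [b [Xa Yb ->]]] [c [d [Xc Yd ->]]].
  by exists (a + c), (b + d); rewrite addrACA; split; [exact: XD|exact: YD|].
- move=> e _ [a [b [Xa Yb ->]]].
  by exists (e * a), (e * b); rewrite mulrDr; split; [exact: XL|exact: YL|].
- move=> e _ [a [b [Xa Yb ->]]].
  by exists (a * e), (b * e); rewrite mulrDl; split; [exact: XR|exact: YR|].
Qed.

Lemma pow_span_is_ideal X n : is_ideal X -> is_ideal (pow_span X n).
Proof.
move=> hX; elim: n => [|n [_ _ _ IH]]; first by split.
by case: hX => _ _ hX _; exact: mul_span_is_ideal.
Qed.

Lemma ideal_is_ideal (J : ideal R) : is_ideal [set` J].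
Proof.
split=> [|u v|a u|a u] /=; first exact: rpred0.
- exact: rpredD.
- exact: ideal_mull.
- exact: ideal_mulr.
Qed.

End ProductsOfSubsets.

Definition bracket (R : pzRingType) (x y : R) : R := x * y - y * x.

Definition pxy_ideal (p : nat) (R : pzRingType) (x y : R) : ideal R :=
  gen_ideal [set p%:R; x; y].

(* The monoid algebra over the integers of the free monoid on two letters. *)
Definition Zxy : nzRingType := {malg int[{fmonom 'I_2}]}.
Definition Zx : Zxy := << fmu (0 : 'I_2) >>.
Definition Zy : Zxy := << fmu (1 : 'I_2) >>.

Section RingA.
Variables p n : nat.

Let M : set Zxy := [set` pxy_ideal p Zx Zy].
Let c : Zxy := bracket Zx Zy.

Definition relI : set Zxy :=
  sum_set (mul_span (mul_span M [set c]) setT)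
          (mul_span (mul_span setT [set c]) M).

Definition relA : set Zxy := sum_set relI (pow_span M n).

Lemma relA_is_ideal : is_ideal relA.
Proof.
have hM : is_ideal M by exact: ideal_is_ideal.
case: (hM) => _ _ ML MR.
apply: sum_set_is_ideal; last exact: pow_span_is_ideal.
apply: sum_set_is_ideal; apply: mul_span_is_ideal => // a u;
  exact: mul_span_mull.
Qed.

Definition ringA : pzRingType := quot_ring (ideal_of_set relA_is_ideal).
Definition projA : {rmorphism Zxy -> ringA} :=
  quot_proj (ideal_of_set relA_is_ideal).
Definition xA : ringA := projA Zx.
Definition yA : ringA := projA Zy.

End RingA.

Section Stage.
Variables (p : nat) (R : pzRingType).

Definition annihilator (x y : R) : set R :=
  [set r | forall u, u \in pxy_ideal p x y -> r * u = 0 /\ u * r = 0].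

(* A scalar [m : 'F_p] acts on an element [r] killed by [p] as [r *+ m], with
   [m] coerced to its representative in [nat]. *)
Definition Fp_multiples (r : R) : set R := [set r *+ m | m in [set: 'F_p]].

Definition Fp_basis (W : set R) (B : {fset R}) : Prop :=
  [/\ forall b, b \in B -> W b,
      forall f : R -> 'F_p, \sum_(b <- B) b *+ f b = 0 ->
        forall b, b \in B -> f b = 0
    & forall w, W w -> exists f : R -> 'F_p, w = \sum_(b <- B) b *+ f b].

Definition choice_ideal (x y : R) (V : {fset R}) (m : R -> 'F_p) : ideal R :=
  gen_ideal [set v - bracket x y *+ m v | v in [set` V]].

End Stage.

(* [procedure_stage p x y i phi] : the ring [R] can be the [i]-th one, and [phi]
   is the projection of [A] onto it; it carries [x, y] to their images. The
   bases are finite sets because A, hence every stage, is finite. *)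
Inductive procedure_stage (p : nat) (A : pzRingType) (x y : A) :
    nat -> forall R : pzRingType, {rmorphism A -> R} -> Prop :=
| Stage0 : procedure_stage p x y 0 (idfun : {rmorphism A -> A})
| StageS (i : nat) (R : pzRingType) (phi : {rmorphism A -> R})
    (V : {fset R}) (m : R -> 'F_p) of
    procedure_stage p x y i phi
  & annihilator p (phi x) (phi y) <> Fp_multiples p (bracket (phi x) (phi y))
  & bracket (phi x) (phi y) \notin V
  & Fp_basis p (annihilator p (phi x) (phi y))
      (bracket (phi x) (phi y) |` V)%fset :
    procedure_stage p x y i.+1
      (quot_proj (choice_ideal (phi x) (phi y) V m) \o phi
         : {rmorphism A -> quot_ring (choice_ideal (phi x) (phi y) V m)}).

Definition procedure_output (p : nat) (A : pzRingType) (x y : A)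
    (N : nat) (R : pzRingType) (phi : {rmorphism A -> R}) : Prop :=
  procedure_stage p x y N phi /\
  annihilator p (phi x) (phi y) = Fp_multiples p (bracket (phi x) (phi y)).

(* Equality of two quotients of A: an isomorphism under A. *)
Definition same_quotient (A R S : pzRingType)
    (f : {rmorphism A -> R}) (g : {rmorphism A -> S}) : Prop :=
  exists h : {rmorphism R -> S}, bijective h /\ forall a, h (f a) = g a.

(* Main.v *)
(* Write M = (p, x, y) and c = [x, y]. In every homomorphic image R of A one has
   Mc = cM = 0 and M^n = 0, so every commutator is a multiple of c, every nonzero
   ideal meets the two-sided annihilator of M, and M^2 is central. It follows
   that R is minimal noncommutative iff R is nonzero and its annihilator is F_p c:
   - if so, every nonzero ideal contains c, so proper quotients are commutative;
     a subring with two noncommuting elements contains x and y modulo M^2, hence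
     is R by nilpotence of M;
   - conversely, a nonzero e in the annihilator spans an ideal F_p e, which
     contains c as R/(e) is commutative, so F_p e = F_p c.
   For the procedure, c survives at each stage because it is independent of the
   v - m_v c; and a minimal noncommutative A/J below a stage R_i forces the
   scalars m_v for which A/J is below R_{i+1}. The kernels grow strictly, so some
   stage has annihilator F_p c, and then its kernel is J, as a bigger ideal J
   would contain c. *)

From HB Require Import structures.
Require Import Defs.
From mathcomp Require Import all_boot all_algebra finmap.
From mathcomp Require Import generic_quotient ring_quotient.
From mathcomp Require Import boolp classical_sets.
From mathcomp.multinomials Require Import monalg.

Set Implicit Arguments.
Unset Strict Implicit.
Unset Printing Implicit Defensive.

Import GRing.Theory.

Local Open Scope classical_set_scope.
Local Open Scope ring_scope.

(** * Scalars of F_p acting on an element killed by p *)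

Section FpScaling.
Variables (p : nat) (V : zmodType) (e : V).
Hypotheses (hp : prime p) (he : e *+ p = 0).

Lemma mulrn_modn (k : nat) : e *+ (k %% p) = e *+ k.
Proof. by rewrite {2}(divn_eq k p) mulrnDr mulnC mulrnA he mul0rn add0r. Qed.

Lemma mulrn_natF (k : nat) : e *+ (k%:R : 'F_p) = e *+ k.
Proof. by rewrite val_Fp_nat // mulrn_modn. Qed.

Lemma mulrnFD (a b : 'F_p) : e *+ (a + b)%R = e *+ a + e *+ b.
Proof.
have -> : (a + b)%R = (a + b)%N%:R :> 'F_p by rewrite natrD !natr_Zp.
by rewrite mulrn_natF mulrnDr.
Qed.

Lemma mulrnFM (a b : 'F_p) : e *+ (a * b)%R = e *+ a *+ b.
Proof.
have -> : (a * b)%R = (a * b)%N%:R :> 'F_p by rewrite natrM !natr_Zp.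
by rewrite mulrn_natF mulrnA.
Qed.

Lemma mulrnFN (a : 'F_p) : e *+ (- a)%R = - (e *+ a).
Proof. by apply/eqP; rewrite -addr_eq0 -mulrnFD addNr. Qed.

Lemma mulrnF_sum (I : Type) (r : seq I) (F : I -> 'F_p) :
  e *+ (\sum_(i <- r) F i)%R = \sum_(i <- r) e *+ F i.
Proof.
elim: r => [|i r IH]; first by rewrite !big_nil.
by rewrite !big_cons mulrnFD IH.
Qed.

Lemma mulrz_intF (z : int) : e *+ (z%:~R : 'F_p) = e *~ z.
Proof.
have hk (k : nat) : e *+ (k%:~R : 'F_p) = e *~ k.
  by rewrite -!pmulrn mulrn_natF.
by case: z => k; rewrite ?NegzE ?mulrNz ?mulrnFN hk.
Qed.

Lemma mulrnF_inj (a : 'F_p) : e != 0 -> e *+ a = 0 -> a = 0.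
Proof.
move=> e0 ea; apply/eqP; apply: contraTT e0 => a0; rewrite negbK.
(* A nonzero a is invertible, so e = (e *+ a) *+ a^-1 would vanish. *)
by rewrite -[e]mulr1n -(mulrn_natF 1) -(divff a0) mulrnFM ea mul0rn.
Qed.

End FpScaling.

(** Both [subring_closed] and [generated_by] are phrased with subtraction; this recovers opposites,
    sums and integer multiples. *)
Lemma subgroup_closed (V : zmodType) (P : V -> Prop) :
  P 0 -> (forall a b, P a -> P b -> P (a - b)) ->
  [/\ forall a, P a -> P (- a), forall a b, P a -> P b -> P (a + b)
    & forall a (k : int), P a -> P (a *~ k)].
Proof.
move=> P0 PB.
have PN a : P a -> P (- a) by rewrite -sub0r; exact: PB.
have PD a b : P a -> P b -> P (a + b).
  by move=> ha hb; rewrite -(opprK b); apply: PB => //; exact: PN.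
split=> // a k ha; have Pn (i : nat) : P (a *+ i).
  by elim: i => [|i IH]; rewrite ?mulrS //; exact: PD.
by case: k => k; rewrite ?NegzE ?mulrNz -?pmulrn //; exact/PN.
Qed.

Lemma gen_ideal_min (R : pzRingType) (G X : set R) (r : R) :
  is_ideal X -> (forall g, G g -> X g) -> r \in gen_ideal G -> X r.
Proof.
move=> hX hG /asboolP hr; apply/asboolP.
by apply: (hr (ideal_of_set hX)) => g /hG Xg; apply/asboolP.
Qed.

Lemma mem_gen_ideal (R : pzRingType) (G : set R) (g : R) :
  G g -> g \in gen_ideal G.
Proof. by move=> Gg; apply/asboolP => J; apply. Qed.

(** * Powers of an ideal *)

Section PowSpan.
Variables (R : pzRingType) (X : set R).
Hypothesis hX : is_ideal X.

Lemma pow_spanM i j u v :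
  pow_span X i u -> pow_span X j v -> pow_span X (i + j) (u * v).
Proof.
elim: i u => [|i IH] u hu hv.
  by have [_ _ h _] := pow_span_is_ideal j hX; exact: h.
case: hu => s hs ->; exists [seq (w.1, w.2 * v) | w <- s].
  by move=> _ /mapP[w /hs[Xw hw] ->]; split => //=; exact: IH.
by rewrite big_map mulr_suml; apply: eq_bigr => w _; rewrite mulrA.
Qed.

Lemma pow_span1 u : X u -> pow_span X 1 u.
Proof.
by exists [:: (u, 1)]; rewrite ?big_seq1 ?mulr1 // => w; rewrite inE => /eqP ->.
Qed.

Lemma mul_span_min (Y Z : set R) u :
  (forall a b, Y a -> Z b -> X (a * b)) -> mul_span Y Z u -> X u.
Proof.
case: hX => X0 XD _ _ XM [s hs ->]; rewrite big_seq; apply: big_ind => //.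
by move=> w /hs[]; exact: XM.
Qed.

Lemma mul_span_subl (Y : set R) u : mul_span X Y u -> X u.
Proof.
by have [_ _ _ XR] := hX; apply: mul_span_min => a b Xa _; exact: XR.
Qed.

End PowSpan.

(** * Rings generated by x and y, with M nilpotent and killing c *)

Definition generated_by (R : pzRingType) (x y : R) : Prop :=
  forall P : R -> Prop, P 1 -> (forall a b, P a -> P b -> P (a - b)) ->
    (forall a b, P a -> P b -> P (a * b)) -> P x -> P y -> forall r, P r.

(** These properties pass to homomorphic images, so they hold for A, for every quotient of A and for
    every stage. Generation is stated as an induction principle, the form in which it is applied. *)
Record pxy_nilpotent_ring (p n : nat) (R : pzRingType) (x y : R) : Prop := {
  bracket_annl : forall u, u \in pxy_ideal p x y -> u * bracket x y = 0;
  bracket_annr : forall u, u \in pxy_ideal p x y -> bracket x y * u = 0;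
  pxy_nilpotent : forall u, pow_span [set` pxy_ideal p x y] n u -> u = 0;
  pxy_generated : generated_by x y
}.

(** * Commutator identities: biadditivity and the Leibniz rule *)

Lemma bracketMl (R : pzRingType) (a b t : R) :
  bracket (a * b) t = a * bracket b t + bracket a t * b.
Proof. by rewrite /bracket mulrBr mulrBl !mulrA subrKA. Qed.

Lemma bracketN (R : pzRingType) (a t : R) : bracket a t = - bracket t a.
Proof. by rewrite /bracket opprB. Qed.

Lemma bracketMr (R : pzRingType) (a b t : R) :
  bracket t (a * b) = a * bracket t b + bracket t a * b.
Proof. by rewrite bracketN bracketMl opprD -mulrN -mulNr -!bracketN. Qed.

Lemma bracketDl (R : pzRingType) (a b t : R) :
  bracket (a + b) t = bracket a t + bracket b t.
Proof. by rewrite /bracket mulrDl mulrDr opprD addrACA. Qed.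

Lemma bracketBl (R : pzRingType) (a b t : R) :
  bracket (a - b) t = bracket a t - bracket b t.
Proof.
rewrite bracketDl; congr (_ + _).
by rewrite /bracket mulNr mulrN opprK opprB addrC.
Qed.

Lemma bracketBr (R : pzRingType) (a b t : R) :
  bracket t (a - b) = bracket t a - bracket t b.
Proof. by rewrite bracketN bracketBl opprB -bracketN addrC -bracketN. Qed.

Lemma bracketDr (R : pzRingType) (a b t : R) :
  bracket t (a + b) = bracket t a + bracket t b.
Proof. by rewrite bracketN bracketDl opprD -!bracketN. Qed.

Lemma bracketzl (R : pzRingType) (a t : R) (k : int) :
  bracket (a *~ k) t = bracket a t *~ k.
Proof. by rewrite /bracket mulrzBl mulrzAl mulrzAr. Qed.

Lemma bracketzr (R : pzRingType) (a t : R) (k : int) :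
  bracket t (a *~ k) = bracket t a *~ k.
Proof. by rewrite bracketN bracketzl -mulNrz -bracketN. Qed.

Lemma bracket_eq0 (R : pzRingType) (a t : R) :
  bracket a t = 0 <-> a * t = t * a.
Proof.
by split=> [/eqP|/eqP h]; [rewrite subr_eq0 => /eqP | apply/eqP; rewrite subr_eq0].
Qed.

Lemma bracket1l (R : pzRingType) (t : R) : bracket 1 t = 0.
Proof. by rewrite /bracket mul1r mulr1 subrr. Qed.

Lemma bracketii (R : pzRingType) (t : R) : bracket t t = 0.
Proof. by rewrite /bracket subrr. Qed.

(** * The ideal M modulo its square *)

Section PxyIdeal.
Variables (p : nat) (R : pzRingType) (x y : R).

Lemma pxy_ideal_min (X : set R) u :
  is_ideal X -> X p%:R -> X x -> X y -> u \in pxy_ideal p x y -> X u.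
Proof. by move=> hX Xp Xx Xy; apply: gen_ideal_min => // g [[]|] ->. Qed.

Lemma pxy_p : p%:R \in pxy_ideal p x y.
Proof. by apply: mem_gen_ideal; do 2 left. Qed.

Lemma pxy_x : x \in pxy_ideal p x y.
Proof. by apply: mem_gen_ideal; left; right. Qed.

Lemma pxy_y : y \in pxy_ideal p x y.
Proof. by apply: mem_gen_ideal; right. Qed.

Lemma pxy_is_ideal : is_ideal [set` pxy_ideal p x y].
Proof. exact: ideal_is_ideal. Qed.

Hypothesis gen : generated_by x y.

(** Since M is an ideal, Z + M is a subring; it contains x and y. *)
Lemma scalar_plus_pxy r :
  exists (k : int) m, m \in pxy_ideal p x y /\ r = k%:~R + m.
Proof.
have [M0 MD ML MR] := pxy_is_ideal.
apply: (gen (P := fun r => exists (k : int) m,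
  m \in pxy_ideal p x y /\ r = k%:~R + m)).
- by exists 1, 0; rewrite addr0.
- move=> _ _ [k [m [hm ->]]] [l [m' [hm' ->]]]; exists (k - l), (m - m').
  by rewrite rpredB // intrB opprD addrACA.
- move=> _ _ [k [m [hm ->]]] [l [m' [hm' ->]]].
  exists (k * l), (k%:~R * m' + m * (l%:~R + m')); split.
    by apply: MD; [apply: ML | apply: MR].
  by rewrite intrM mulrDl mulrDr addrA.
- by exists 0, x; rewrite add0r; split => //; exact: pxy_x.
- by exists 0, y; rewrite add0r; split => //; exact: pxy_y.
Qed.

(** Because R = Z + M, multiplying an element of M by k + m amounts to multiplying it by k modulo
    M^2. So the integer span of p, x, y together with M^2 is already an ideal. *)
Lemma pxy_linear u : u \in pxy_ideal p x y ->
  exists (i j k : int) w, pow_span [set` pxy_ideal p x y] 2 w /\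
    u = p%:R *~ i + x *~ j + y *~ k + w.
Proof.
have hM := pxy_is_ideal; have [M0 MD ML MR] := hM.
have [P0 PD PL PR] := pow_span_is_ideal 2 hM.
pose X u := exists (i j k : int) w, pow_span [set` pxy_ideal p x y] 2 w /\
    u = p%:R *~ i + x *~ j + y *~ k + w.
(* Membership in M is carried along, so that a product with m in M falls into M^2. *)
suff hX : is_ideal [set u | u \in pxy_ideal p x y /\ X u].
  move=> hu; suff [] : u \in pxy_ideal p x y /\ X u by [].
  apply: (pxy_ideal_min hX) hu; split.
  - exact: pxy_p.
  - by exists 1, 0, 0, 0; split => //; rewrite !mulr0z mulr1z !addr0.
  - exact: pxy_x.
  - by exists 0, 1, 0, 0; split => //; rewrite !mulr0z mulr1z add0r !addr0.
  - exact: pxy_y.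
  - by exists 0, 0, 1, 0; split => //; rewrite !mulr0z mulr1z !add0r !addr0.
have XD a b : X a -> X b -> X (a + b).
  move=> [i [j [k [w [hw ->]]]]] [i' [j' [k' [w' [hw' ->]]]]].
  exists (i + i'), (j + j'), (k + k'), (w + w'); split; first exact: PD.
  by rewrite !mulrzDr; rewrite addrACA; congr (_ + _);
     rewrite addrACA; congr (_ + _); rewrite addrACA.
have XZ a (l : int) : X a -> X (a *~ l).
  move=> [i [j [k [w [hw ->]]]]].
  exists (i * l), (j * l), (k * l), (w *~ l); split.
    by rewrite -mulrzr; exact: PR.
  by rewrite !mulrzDl !mulrzA.
have X2 w : pow_span [set` pxy_ideal p x y] 2 w -> X w.
  by exists 0, 0, 0, w; rewrite !mulr0z !add0r.
split=> [|b c [Mb Xb] [Mc Xc]|a b [Mb Xb]|a b [Mb Xb]] /=.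
- by split; [exact: M0 | exact: X2].
- by split; [exact: MD | exact: XD].
- split; first exact: ML.
  have [l [m [hm ->]]] := scalar_plus_pxy a.
  rewrite mulrDl mulrzl; apply: XD; first exact: XZ.
  by apply: X2; apply: (pow_spanM hM (i := 1) (j := 1)); exact: pow_span1.
- split; first exact: MR.
  have [l [m [hm ->]]] := scalar_plus_pxy a.
  rewrite mulrDr mulrzr; apply: XD; first exact: XZ.
  by apply: X2; apply: (pow_spanM hM (i := 1) (j := 1)); exact: pow_span1.
Qed.

End PxyIdeal.

(** * Transport along surjective morphisms *)

Section Surjection.
Variables (p n : nat) (R S : pzRingType) (f : {rmorphism R -> S}) (x y : R).
Hypothesis f_surj : forall s, exists r, f r = s.

Lemma image_is_ideal (X : set R) : is_ideal X -> is_ideal (f @` X).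
Proof.
case=> X0 XD XL XR; split.
- by exists 0 => //; rewrite rmorph0.
- move=> _ _ [a Xa <-] [b Xb <-]; exists (a + b); first exact: XD.
  by rewrite rmorphD.
- move=> s _ [a Xa <-]; have [r <-] := f_surj s.
  by exists (r * a); [exact: XL | rewrite rmorphM].
- move=> s _ [a Xa <-]; have [r <-] := f_surj s.
  by exists (a * r); [exact: XR | rewrite rmorphM].
Qed.

(** By surjectivity the image of M is an ideal, and it contains the three generators. *)
Lemma pxy_ideal_lift u : u \in pxy_ideal p (f x) (f y) ->
  exists2 v, v \in pxy_ideal p x y & f v = u.
Proof.
apply: (pxy_ideal_min (X := f @` [set` pxy_ideal p x y])).
- exact: (image_is_ideal (pxy_is_ideal p x y)).
- by exists p%:R; [exact: pxy_p | rewrite rmorph_nat].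
- by exists x; first exact: pxy_x.
- by exists y; first exact: pxy_y.
Qed.

Lemma pxy_ideal_map v :
  v \in pxy_ideal p x y -> f v \in pxy_ideal p (f x) (f y).
Proof.
have [M0 MD ML MR] := pxy_is_ideal p (f x) (f y).
apply: (pxy_ideal_min (X := [set v | f v \in pxy_ideal p (f x) (f y)])).
- split=> [|a b ha hb|a b hb|a b hb] /=.
  + by rewrite rmorph0.
  + by rewrite rmorphD; exact: MD.
  + by rewrite rmorphM; exact: ML.
  + by rewrite rmorphM; exact: MR.
- by rewrite /= rmorph_nat; exact: pxy_p.
- exact: pxy_x.
- exact: pxy_y.
Qed.

Lemma pow_span_lift (X : set R) (Y : set S) i u :
  (forall s, Y s -> exists2 r, X r & f r = s) ->
  pow_span Y i u -> exists2 v, pow_span X i v & f v = u.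
Proof.
move=> hXY; elim: i u => [|i IH] u.
  by move=> _; have [v <-] := f_surj u; exists v.
case=> s hs ->; elim: s hs => [|[a b] s IHs] hs.
  by exists 0; rewrite ?big_nil ?rmorph0 //; exists [::]; rewrite ?big_nil.
have [/= /hXY[a' Xa' <-] /IH[b' hb' <-]] := hs _ (mem_head _ _).
have [|v [t ht ->] hv] := IHs.
  by move=> z zs; apply: (hs z); rewrite inE zs orbT.
exists (a' * b' + \sum_(w <- t) w.1 * w.2); last first.
  by rewrite big_cons -hv rmorphD rmorphM.
exists ((a', b') :: t); last by rewrite big_cons.
by move=> w; rewrite inE => /orP[/eqP ->|/ht].
Qed.

Lemma generated_by_map : generated_by x y -> generated_by (f x) (f y).
Proof.
move=> gen P P1 PB PM Px Py s; have [r <-] := f_surj s.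
apply: (gen (fun r => P (f r))) => // [|a b|a b].
- by rewrite rmorph1.
- by rewrite rmorphB; exact: PB.
- by rewrite rmorphM; exact: PM.
Qed.

Lemma map_bracket a b : f (bracket a b) = bracket (f a) (f b).
Proof. by rewrite /bracket rmorphB !rmorphM. Qed.

Lemma pxy_nilpotent_map :
  pxy_nilpotent_ring p n x y -> pxy_nilpotent_ring p n (f x) (f y).
Proof.
case=> hl hr hn gen; split.
- move=> u /pxy_ideal_lift[v /hl hv <-].
  by rewrite -map_bracket -rmorphM hv rmorph0.
- move=> u /pxy_ideal_lift[v /hr hv <-].
  by rewrite -map_bracket -rmorphM hv rmorph0.
- move=> u /(pow_span_lift (X := [set` pxy_ideal p x y])) [|v hv <-].
    exact: pxy_ideal_lift.
  by rewrite (hn _ hv) rmorph0.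
- exact: generated_by_map.
Qed.

End Surjection.

Lemma quot_proj_surj (R : pzRingType) (J : ideal R) u :
  exists r, quot_proj J r = u.
Proof. by exists (repr (u : Quotient.quot J)); exact: quot_projK. Qed.

Lemma quot_proj_eq0 (R : pzRingType) (J : ideal R) r :
  quot_proj J r = 0 <-> r \in J.
Proof. by rewrite -(raddf0 (quot_proj J)) quot_proj_eqP subr0. Qed.

(** * Annihilator, commutators and subrings *)

Section PxyNilpotent.
Variables (p n : nat) (R : pzRingType) (x y : R).
Hypotheses (hp : prime p) (hR : pxy_nilpotent_ring p n x y).

Let M : set R := [set` pxy_ideal p x y].
Let c : R := bracket x y.

Lemma bracket_mulrnp : c *+ p = 0.
Proof. by rewrite -mulr_natl; apply: (bracket_annl hR); exact: pxy_p. Qed.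

Lemma annihilator_mulrnp r : annihilator p x y r -> r *+ p = 0.
Proof. by move=> hr; rewrite -mulr_natr; case: (hr p%:R (pxy_p p x y)). Qed.

(** As R = Z + M and M kills r, the ring acts on r through integers; hence the multiples of r form a
    two-sided ideal. *)
Lemma annihilator_mulrl r a :
  annihilator p x y r -> exists k : int, a * r = r *~ k.
Proof.
move=> hr; have [k [m [hm ->]]] := scalar_plus_pxy p (pxy_generated hR) a.
by exists k; have [_ e] := hr m hm; rewrite mulrDl e addr0 mulrzl.
Qed.

Lemma annihilator_mulrr r a :
  annihilator p x y r -> exists k : int, r * a = r *~ k.
Proof.
move=> hr; have [k [m [hm ->]]] := scalar_plus_pxy p (pxy_generated hR) a.
by exists k; have [e _] := hr m hm; rewrite mulrDr e addr0 mulrzr.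
Qed.

Lemma annihilator_mulrz r (k : int) :
  annihilator p x y r -> annihilator p x y (r *~ k).
Proof.
move=> hr u /hr[e e'].
by rewrite -mulrzl -mulrA e mulr0 mulrzl mulrzAr e' mul0rz.
Qed.

Lemma annihilatorD r s :
  annihilator p x y r -> annihilator p x y s -> annihilator p x y (r + s).
Proof.
by move=> hr hs u hu; have [e e'] := hr u hu; have [g g'] := hs u hu;
   rewrite mulrDl mulrDr e e' g g' addr0.
Qed.

Lemma annihilator_bracket : annihilator p x y c.
Proof. by move=> u hu; rewrite (bracket_annl hR) ?(bracket_annr hR). Qed.

Lemma Fp_multiples_annihilator r : Fp_multiples p c r -> annihilator p x y r.
Proof.
by case=> m _ <-; rewrite pmulrn; exact/annihilator_mulrz/annihilator_bracket.
Qed.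

Lemma mulrz_is_ideal r :
  annihilator p x y r -> is_ideal [set r *~ k | k in setT].
Proof.
move=> hr; split.
- by exists 0.
- by move=> _ _ [k _ <-] [l _ <-]; exists (k + l); rewrite ?mulrzDr.
- move=> a _ [k _ <-]; have [l e] := annihilator_mulrl a hr.
  by exists (l * k); rewrite // mulrzAr e mulrzA.
- move=> a _ [k _ <-]; have [l e] := annihilator_mulrr a hr.
  by exists (l * k); rewrite // mulrzAl e mulrzA.
Qed.

(** The multiples of c form an ideal Z, so by the Leibniz rule the elements whose bracket with a
    fixed one lies in Z form a subring. Testing both arguments on x and y leaves only c. *)
Lemma bracket_multiple s t : exists k : int, bracket s t = c *~ k.
Proof.
pose Z := [set c *~ k | k in [set: int]].
have [Z0 ZD ZL ZR] : is_ideal Z := mulrz_is_ideal annihilator_bracket.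
have ZB a b : Z a -> Z b -> Z (a - b).
  by move=> ha hb; rewrite -mulN1r; apply/ZD/ZL.
have ZN a : Z a -> Z (- a) by rewrite -mulN1r; exact: ZL.
suff [k _ <-] : Z (bracket s t) by exists k.
have gen := pxy_generated hR.
have Zr u : Z (bracket u x) -> Z (bracket u y) -> forall t, Z (bracket u t).
  move=> ux uy; apply: gen => //.
  - by rewrite bracketN bracket1l oppr0.
  - by move=> a b ha hb; rewrite bracketBr; exact: ZB.
  - by move=> a b ha hb; rewrite bracketMr; apply: (ZD); [exact: ZL|exact: ZR].
have Zc : Z c by exists 1.
move: s; apply: gen => [|a b ha hb|a b ha hb||].
- by rewrite bracket1l.
- by rewrite bracketBl; exact: ZB.
- by rewrite bracketMl; apply: (ZD); [exact: ZL|exact: ZR].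
- by apply: Zr => //; rewrite bracketii.
- by apply: Zr => //; rewrite ?bracketii // bracketN; exact: ZN.
Qed.

Lemma commutative_bracket0 : c = 0 -> commutative_ring R.
Proof.
move=> c0 s t; apply/bracket_eq0.
by have [k ->] := bracket_multiple s t; rewrite c0 mul0rz.
Qed.

(** For a, b in M, [ab, t] = a[b, t] + [a, t]b lies in Mc + cM = 0. *)
Lemma bracket_pow2 w t : pow_span M 2 w -> bracket w t = 0.
Proof.
have hM : is_ideal M := pxy_is_ideal p x y.
case=> s hs ->; elim: s hs => [|[a b] s IH] hs.
  by rewrite big_nil /bracket mul0r mulr0 subrr.
have [/= Ma /(mul_span_subl hM) Mb] := hs _ (mem_head _ _).
rewrite big_cons bracketDl IH ?addr0 /=; last first.
  by move=> z zs; apply: (hs z); rewrite inE zs orbT.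
have [k bt] := bracket_multiple b t; have [l at_] := bracket_multiple a t.
rewrite bracketMl bt at_ mulrzAr mulrzAl.
by rewrite (bracket_annl hR) // (bracket_annr hR) // !mul0rz addr0.
Qed.

(* Multiplying a nonzero element by elements of M, first on the left and then on
   the right, for as long as the result is nonzero ends in the annihilator. *)
Lemma ideal_meets_annihilator (X : set R) r :
  is_ideal X -> X r -> r != 0 ->
  exists e, [/\ X e, e != 0 & annihilator p x y e].
Proof.
move=> hX; have [X0 XD XL XR] := hX.
have hM : is_ideal M := pxy_is_ideal p x y.
have left_ann j : forall r, X r -> r != 0 ->
    (forall u, pow_span M j u -> u * r = 0) ->
    exists e, [/\ X e, e != 0 & forall u, M u -> u * e = 0].
  elim: j => [|j IH] s Xs s0 hs.
    (* [pow_span M 0] is the whole ring, so the hypothesis applies to 1. *)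
    by move: s0; rewrite -(mul1r s) hs ?eqxx.
  have [h|/existsNP[u /not_implyP[hu /eqP us]]] :=
    pselect (forall u, pow_span M j u -> u * s = 0).
    exact: IH h.
  exists (u * s); split => //; first exact: XL.
  move=> m hm; rewrite mulrA; apply: hs.
  by apply: (pow_spanM hM (i := 1)) => //; exact: pow_span1.
have right_ann j : forall r, X r -> r != 0 -> (forall u, M u -> u * r = 0) ->
    (forall u, pow_span M j u -> r * u = 0) ->
    exists e, [/\ X e, e != 0 & annihilator p x y e].
  elim: j => [|j IH] s Xs s0 ls hs.
    by move: s0; rewrite -(mulr1 s) hs ?eqxx.
  have [h|/existsNP[u /not_implyP[hu /eqP su]]] :=
    pselect (forall u, pow_span M j u -> s * u = 0).
    exact: IH h.
  exists (s * u); split => //; first exact: XR.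
  (* Multiplying s on the right preserves its annihilation by M on the left. *)
  move=> m hm; rewrite mulrA ls // mul0r -mulrA hs //.
  by rewrite -addn1; apply: pow_spanM => //; exact: pow_span1.
move=> Xr r0.
have [|e [Xe e0 le]] := left_ann n r Xr r0.
  by move=> u /(pxy_nilpotent hR) ->; rewrite mul0r.
apply: (right_ann n e) => // u /(pxy_nilpotent hR) ->; exact: mulr0.
Qed.

(* Nakayama-type step: S + M^2 covers M, hence S + M^(k+1) covers M^k. *)
Lemma pow_span_cover (S : {pred R}) : subring_closed S ->
  (forall u, M u -> exists2 s, s \in S & pow_span M 2 (u - s)) ->
  forall k u, pow_span M k u -> exists2 s, s \in S & pow_span M k.+1 (u - s).
Proof.
move=> hS cov; have [S1 SB SM] := hS.
have S0 : 0 \in S by rewrite -(subrr 1); exact: SB.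
have [_ SD SZ] := subgroup_closed (P := fun a => a \in S) S0 SB.
have hM : is_ideal M := pxy_is_ideal p x y.
have hP j : is_ideal (pow_span M j) by exact: pow_span_is_ideal.
elim=> [u _|k IH u].
  have [l [m [hm ->]]] := scalar_plus_pxy p (pxy_generated hR) u.
  by exists l%:~R; [exact: SZ | rewrite addrAC subrr add0r; exact: pow_span1].
case=> s hs ->; elim: s hs => [|[a b] s IHs] hs.
  by exists 0; rewrite ?big_nil ?subrr //; have [] := hP k.+2.
have [/= Ma Mb] := hs _ (mem_head _ _).
have [|t St ht] := IHs.
  by move=> z zs; apply: (hs z); rewrite inE zs orbT.
have [a' Sa' ha'] := cov a Ma; have [b' Sb' hb'] := IH b Mb.
exists (a' * b' + t); first by apply: (SD) => //; exact: SM.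
have [_ PD PL PR] := hP k.+2.
rewrite big_cons opprD addrACA; apply: (PD) => //=.
(* The two terms lie in M^2 M^k and in M M^(k+1); here a' is in M because a and a - a' are. *)
have -> : a * b - a' * b' = (a - a') * b + a' * (b - b').
  by rewrite mulrBl mulrBr subrKA.
apply: PD; first exact: (pow_spanM hM ha' Mb).
apply: (pow_spanM hM (i := 1)) => //; apply: pow_span1.
rewrite -[a'](subKr a); apply: rpredB; first exact: Ma.
exact: (mul_span_subl hM ha').
Qed.

(** Starting from M^0 = R, the covering step gives R = S + M^k for every k, and M^n = 0. *)
Lemma subring_full (S : {pred R}) : subring_closed S ->
  (forall u, M u -> exists2 s, s \in S & pow_span M 2 (u - s)) ->
  forall r, r \in S.
Proof.
move=> hS cov r; have [S1 SB SM] := hS.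
have S0 : 0 \in S by rewrite -(subrr 1); exact: SB.
have [_ SD _] := subgroup_closed (P := fun a => a \in S) S0 SB.
suff h k : exists2 s, s \in S & pow_span M k (r - s).
  have [s Ss /(pxy_nilpotent hR)/eqP] := h n.
  by rewrite subr_eq0 => /eqP ->.
elim: k => [|k [s Ss hs]]; first by exists 0.
have [t St ht] := pow_span_cover hS cov hs.
by exists (s + t); [exact: SD | rewrite opprD addrA].
Qed.

(* Since M^2 is central, [s, t] = (a b' - b a')[x, y], where (a, b) and (a', b')
   are the coordinates of s and t along x and y. *)
Lemma noncommutative_subring_full (S : {pred R}) s t : subring_closed S ->
  s \in S -> t \in S -> s * t <> t * s -> forall r, r \in S.
Proof.
move=> hS Ss St st; apply: (subring_full hS); have [S1 SB SM] := hS.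
have S0 : 0 \in S by rewrite -(subrr 1); exact: SB.
have [_ SD SZ] := subgroup_closed (P := fun a => a \in S) S0 SB.
have gen := pxy_generated hR.
have hM : is_ideal M := pxy_is_ideal p x y.
have [P0 PD PL PR] : is_ideal (pow_span M 2) by exact: pow_span_is_ideal.
have PB a b : pow_span M 2 a -> pow_span M 2 b -> pow_span M 2 (a - b).
  by move=> ha hb; rewrite -mulN1r; apply: PD => //; exact: PL.
have [PN _ PZ] := subgroup_closed P0 PB.
(* The constant term of u, including the multiple of p, is an integer: it lies in S and is central,
   so it can be subtracted. *)
have norm_form u : u \in S -> exists (a b : int) w,
    [/\ pow_span M 2 w, x *~ a + y *~ b + w \in S
      & forall v, bracket u v = bracket (x *~ a + y *~ b) v].
  move=> Su; have [k [m [hm um]]] := scalar_plus_pxy p gen u.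
  have [i [a [b [w [hw mw]]]]] := pxy_linear gen hm.
  have us : u = (k + p%:Z * i)%:~R + (x *~ a + y *~ b + w).
    rewrite um mw [(_ + _ * _)%:~R]mulrzDr -!addrA; congr (_ + (_ + _)).
    by rewrite mulrzA.
  exists a, b, w; split => // [|v].
    have -> : x *~ a + y *~ b + w = u - (k + p%:Z * i)%:~R.
      by rewrite us [RHS]addrAC subrr add0r.
    by apply: SB => //; exact: SZ.
  rewrite us 2!bracketDl bracketzl bracket1l mul0rz add0r.
  by rewrite (bracket_pow2 v hw) addr0.
have [a [b [w [hw Ss' sv]]]] := norm_form s Ss.
have [a' [b' [w' [hw' St' tv]]]] := norm_form t St.
pose d := a * b' - b * a'.
have std : bracket s t = c *~ d.
  rewrite sv bracketN tv -bracketN.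
  rewrite !bracketDl !bracketDr !bracketzl !bracketzr !bracketii !mul0rz.
  rewrite add0r addr0 (bracketN y x) !mulNrz -!mulrzA -mulrzBr.
  by rewrite mulrC [a' * _]mulrC.
(* If p divided d, then [s, t] = d c would vanish, since p c = 0. *)
have cop : coprimez p%:Z d.
  rewrite coprimezE /= prime_coprime //; apply/negP => hd.
  have /dvdzP[q dq] : (p%:Z %| d)%Z by rewrite dvdzE.
  apply: st; apply/bracket_eq0; rewrite std dq mulrC mulrzA.
  by rewrite -pmulrn bracket_mulrnp mul0rz.
have [e [f ef]] : exists e f : int, e * d = 1 + p%:Z * f.
  have /coprimezP[[f e] /= h] := cop; exists e, (- f).
  by rewrite mulrN -h [p%:Z * _]mulrC addrAC subrr add0r.
(* Since p is itself in M, congruences modulo p between coefficients are absorbed by M^2. *)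
have pM2 u : M u -> forall k, pow_span M 2 (u *~ (p%:Z * k)).
  move=> hu k; rewrite mulrzA; apply: PZ; rewrite -pmulrn -mulr_natr.
  apply: (pow_spanM hM (i := 1) (j := 1)); apply: pow_span1 => //.
  exact: pxy_p.
(* Cramer's rule for the matrix [[a, b], [a', b']], invertible modulo p. *)
have cramer (z z' : R) (a1 b1 a2 b2 e' : int) w1 w2 : M z ->
    pow_span M 2 w1 -> pow_span M 2 w2 ->
    e' * (a1 * b2 - b1 * a2) = 1 + p%:Z * f ->
    z *~ a1 + z' *~ b1 + w1 \in S -> z *~ a2 + z' *~ b2 + w2 \in S ->
    exists2 v, v \in S & pow_span M 2 (z - v).
  move=> Mz hw1 hw2 ed S1z S2z.
  exists ((z *~ a1 + z' *~ b1 + w1) *~ (b2 * e')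
          - (z *~ a2 + z' *~ b2 + w2) *~ (b1 * e')).
    by apply: SB; exact: SZ.
  have -> : (z *~ a1 + z' *~ b1 + w1) *~ (b2 * e')
      - (z *~ a2 + z' *~ b2 + w2) *~ (b1 * e')
    = z + (z *~ (p%:Z * f) + (w1 *~ (b2 * e') - w2 *~ (b1 * e'))).
    rewrite !mulrzDl -!mulrzA.
    have -> : b1 * (b2 * e') = b2 * (b1 * e') by rewrite mulrCA.
    rewrite addrA -{3}[z]mulr1z -mulrzDr -ed.
    have -> : e' * (a1 * b2 - b1 * a2) = a1 * (b2 * e') - a2 * (b1 * e').
      by rewrite mulrC mulrBl -!mulrA [b1 * (_ * _)]mulrCA.
    rewrite mulrzBr opprD addrACA; congr (_ + _).
    by rewrite opprD addrACA subrr addr0.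
  rewrite opprD addrA subrr add0r; apply/PN/PD; first exact: pM2.
  by apply: PB; exact: PZ.
have [zx Sx hx] := cramer _ _ _ _ _ _ _ _ _ (pxy_x p x y) hw hw' ef Ss' St'.
have [zy Sy hy] : exists2 v, v \in S & pow_span M 2 (y - v).
  (* Exchanging x and y changes the sign of the determinant, hence - e. *)
  apply: (cramer y x b a b' a' (- e) w w') => //; try exact: pxy_y.
  - by rewrite -ef mulNr -mulrN opprB.
  - by rewrite [y *~ _ + _]addrC.
  - by rewrite [y *~ _ + _]addrC.
move=> u /(pxy_linear gen)[i [j [k [v [hv ->]]]]].
exists (p%:R *~ i + zx *~ j + zy *~ k).
  apply: (SD); [apply: (SD)|]; apply: (SZ) => //.
  by rewrite pmulrn; exact: SZ.
have -> : p%:R *~ i + x *~ j + y *~ k + v - (p%:R *~ i + zx *~ j + zy *~ k)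
    = (x - zx) *~ j + (y - zy) *~ k + v.
  rewrite addrAC; congr (_ + _); rewrite opprD addrACA [X in _ = _ + X]mulrzBl.
  by congr (_ + _); rewrite opprD addrACA subrr add0r -mulrzBl.
by apply: (PD) => //; apply: (PD); exact: PZ.
Qed.

(** * Minimal noncommutativity and the annihilator *)

Lemma mulrz_coprime (r : R) (k : int) :
  r *+ p = 0 -> r *~ k != 0 -> exists l : int, r *~ k *~ l = r.
Proof.
move=> rp rk; have : (k%:~R : 'F_p) != 0.
  by apply: contra_neq rk => k0; rewrite -(mulrz_intF hp rp) k0.
(* The witness represents the inverse of k modulo p. *)
move=> k0; exists (nat_of_ord (k%:~R : 'F_p)^-1)%:Z.
rewrite -(mulrz_intF hp rp k) -pmulrn.
by rewrite -(mulrnFM hp rp) divff.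
Qed.

(** X contains a nonzero element of the annihilator, that is a nonzero multiple of c, and its
    coefficient can be inverted modulo p. *)
Lemma bracket_in_ideal (X : set R) : annihilator p x y = Fp_multiples p c ->
  is_ideal X -> (exists2 r, X r & r != 0) -> X c.
Proof.
move=> hann hX [r Xr r0]; have [X0 XD XL XR] := hX.
have [e [Xe e0]] := ideal_meets_annihilator hX Xr r0.
rewrite hann => -[m _ me]; move: e0; rewrite -me pmulrn => e0.
have [l <-] := mulrz_coprime bracket_mulrnp e0.
by rewrite -pmulrn me -mulrzr; exact: XR.
Qed.

Lemma minimal_noncommutative_annihilator : minimal_noncommutative R ->
  annihilator p x y = Fp_multiples p c.
Proof.
case=> nc _ hq; apply/seteqP; split=> e; last exact: Fp_multiples_annihilator.
move=> he; have [->|e0] := eqVneq e 0; first by exists 0.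
have c0 : c != 0 by apply: contra_notN nc => /eqP; exact: commutative_bracket0.
have eK : e \in gen_ideal [set e] by exact: mem_gen_ideal.
have : c \in gen_ideal [set e].
  apply/quot_proj_eq0; rewrite map_bracket; apply/bracket_eq0.
  by apply: hq; exists e.
(* The ideal generated by e consists of its integer multiples, so c = k e; as c is nonzero, k is
   invertible modulo p. *)
move/(gen_ideal_min (mulrz_is_ideal he)) => [_ ->|k _ kc]; first by exists 1.
have ep := annihilator_mulrnp he.
have [|l le] := @mulrz_coprime e k ep; first by rewrite kc.
by exists (l%:~R : 'F_p) => //; rewrite (mulrz_intF hp bracket_mulrnp) -kc.
Qed.

Lemma annihilator_minimal_noncommutative : 1 != 0 :> R ->
  annihilator p x y = Fp_multiples p c -> minimal_noncommutative R.
Proof.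
move=> R1 hann.
have c0 : c != 0.
  (* Since 1 is nonzero, the unit ideal provides a nonzero e in the annihilator; it is a multiple of
     c, so c is nonzero. *)
  have hT : is_ideal [set: R] by [].
  have [e [_ e0]] := ideal_meets_annihilator hT (I : setT 1) R1.
  rewrite hann => -[m _ me]; apply: contra_neq e0.
  by rewrite -me => ->; exact: mul0rn.
split.
- by move=> h; move/eqP: c0; apply; apply/bracket_eq0.
- move=> S hS [r rS] s t Ss St; apply: contrapT => st.
  by move: rS; rewrite (noncommutative_subring_full hS Ss St st).
- move=> J hJ u v.
  have cJ : c \in J := bracket_in_ideal hann (ideal_is_ideal J) hJ.
  have [r <-] := quot_proj_surj u; have [s <-] := quot_proj_surj v.
  apply/bracket_eq0; rewrite -map_bracket; apply/quot_proj_eq0.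
  have [k ->] := bracket_multiple r s.
  by rewrite -mulrzr; exact: ideal_mulr.
Qed.

(** * Finiteness of the ring *)

Fixpoint short_words (k : nat) : seq R :=
  if k is k'.+1 then
    1 :: [seq x * w | w <- short_words k'] ++ [seq y * w | w <- short_words k']
  else [::].

Lemma mem_short_wordsS k w : (w \in short_words k.+1) =
  [|| w == 1, w \in [seq x * w | w <- short_words k]
    | w \in [seq y * w | w <- short_words k]].
Proof. by rewrite inE mem_cat. Qed.

(** [short_words k] holds the words of length less than k; a word of length exactly k is a product
    of k elements of M. *)
Lemma short_wordsS_pow k w :
  w \in short_words k.+1 -> w \in short_words k \/ pow_span M k w.
Proof.
have hM : is_ideal M := pxy_is_ideal p x y.
elim: k w => [|k IH] w; first by right.
have step g v : M g -> v \in short_words k.+1 ->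
    {subset [seq g * w | w <- short_words k] <= short_words k.+1} ->
    g * v \in short_words k.+1 \/ pow_span M k.+1 (g * v).
  move=> Mg /IH[hv|hv] sub; first by left; apply: sub; exact: map_f.
  by right; apply: (pow_spanM hM (i := 1)) => //; exact: pow_span1.
rewrite mem_short_wordsS => /or3P[/eqP ->|/mapP[v hv ->]|/mapP[v hv ->]].
- by left; exact: mem_head.
- apply: step => // [|z hz]; first exact: pxy_x.
  by rewrite mem_short_wordsS hz orbT.
- apply: step => // [|z hz]; first exact: pxy_y.
  by rewrite mem_short_wordsS hz !orbT.
Qed.

(** When q kills the ring, coefficients below q suffice, and this finite list enumerates the
    additive subgroup generated by G. *)
Fixpoint multiples_span (q : nat) (G : seq R) : seq R :=
  if G is g :: G' then
    [seq g *+ i + l | i <- iota 0 q, l <- multiples_span q G']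
  else [:: 0].

Section MultiplesSpan.
Variable q : nat.
Hypotheses (q0 : (0 < q)%N) (hq : forall r : R, r *+ q = 0).

Lemma multiples_spanP g G (i : nat) l : l \in multiples_span q G ->
  g *+ i + l \in multiples_span q (g :: G).
Proof.
move=> hl; rewrite (divn_eq i q) mulrnDr mulnC mulrnA hq mul0rn add0r.
by apply: allpairs_f => //; rewrite mem_iota /= ltn_pmod.
Qed.

Lemma multiples_span0 G : 0 \in multiples_span q G.
Proof.
elim: G => [|g G IH]; first exact: mem_head.
by have := multiples_spanP g 0 IH; rewrite mulr0n addr0.
Qed.

Lemma multiples_spanD G r s : r \in multiples_span q G ->
  s \in multiples_span q G -> r + s \in multiples_span q G.
Proof.
elim: G r s => [|g G IH] r s.
  by rewrite !inE => /eqP -> /eqP ->; rewrite addr0.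
move=> /allpairsP[[i l] /= [_ hl ->]] /allpairsP[[j k] /= [_ hk ->]].
by rewrite addrACA -mulrnDr; apply: multiples_spanP; exact: IH.
Qed.

Lemma multiples_spanN G r :
  r \in multiples_span q G -> - r \in multiples_span q G.
Proof.
move=> hr; have -> : - r = r *+ q.-1.
  by apply/eqP; rewrite eq_sym -addr_eq0 -mulrSr prednK // hq.
elim: q.-1 => [|i IH]; first exact: multiples_span0.
by rewrite mulrS; exact: multiples_spanD.
Qed.

Lemma multiples_span_sub G g : g \in G -> g \in multiples_span q G.
Proof.
elim: G => // h G IH; rewrite inE => /orP[/eqP ->|/IH hg].
  by have := multiples_spanP h 1 (multiples_span0 G); rewrite mulr1n addr0.
by have := multiples_spanP h 0 hg; rewrite mulr0n add0r.
Qed.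

Lemma multiples_span_map G a : {in G, forall g, a * g \in multiples_span q G} ->
  {in multiples_span q G, forall r, a * r \in multiples_span q G}.
Proof.
(* The induction runs over a list G' of generators while the target span stays fixed. *)
move=> hG; suff h G' : {subset G' <= G} ->
    {in multiples_span q G', forall r, a * r \in multiples_span q G}.
  exact: h.
elim: G' => [_ r|g G' IH sub r].
  by rewrite inE => /eqP ->; rewrite mulr0 multiples_span0.
move=> /allpairsP[[i l] /= [_ hl ->]]; rewrite mulrDr mulrnAr.
apply: multiples_spanD; last first.
  by apply: IH hl => z hz; apply: sub; rewrite inE hz orbT.
elim: i => [|i IHi]; first exact: multiples_span0.
by rewrite mulrS; apply: multiples_spanD => //; apply/hG/sub/mem_head.
Qed.

End MultiplesSpan.

(* The span of the words of length < n contains 1 and is stable under left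
   multiplication by x and y, hence is everything; and p^n = 0. *)
Lemma pxy_nilpotent_ring_finite : exists L : seq R, forall r, r \in L.
Proof.
have hM : is_ideal M := pxy_is_ideal p x y.
have q0 : (0 < p ^ n)%N by rewrite expn_gt0 prime_gt0.
have hq (r : R) : r *+ (p ^ n) = 0.
  rewrite -mulr_natl natrX (pxy_nilpotent hR (u := p%:R ^+ n)) ?mul0r //.
  elim: n => // k IH; rewrite exprS; apply: (pow_spanM hM (i := 1)) => //.
  by apply: pow_span1; exact: pxy_p.
pose L := multiples_span (p ^ n) (short_words n); exists L.
have Lx g : (forall w, w \in short_words n -> g * w \in short_words n.+1) ->
    {in L, forall r, g * r \in L}.
  move=> sub; apply: multiples_span_map => // w /sub hw.
  have [hg|/(pxy_nilpotent hR) ->] := short_wordsS_pow hw.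
    exact: multiples_span_sub.
  exact: multiples_span0.
(* The r with r L inside L form a subring. To conclude, 1 is in L: either it is a short word, or it
   lies in M^n and equals 0. *)
suff h r : {in L, forall s, r * s \in L}.
  move=> r; rewrite -(mulr1 r); apply: h.
  have h1 : 1 \in short_words n.+1 by exact: mem_head.
  have [{}h1|/(pxy_nilpotent hR) ->] := short_wordsS_pow h1.
    exact: multiples_span_sub.
  exact: multiples_span0.
apply: (pxy_generated hR (P := fun r => {in L, forall s, r * s \in L})).
- by move=> s; rewrite mul1r.
- move=> a b ha hb s hs; rewrite mulrBl; apply: multiples_spanD => //.
    exact: ha.
  by apply: multiples_spanN => //; exact: hb.
- by move=> a b ha hb s hs; rewrite -mulrA; apply/ha/hb.
- by apply: Lx => w hw; rewrite mem_short_wordsS map_f ?orbT.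
- by apply: Lx => w hw; rewrite mem_short_wordsS (map_f ( *%R y) hw) !orbT.
Qed.

(** * Bases of the annihilator and the ideals of choices *)

Lemma ann_basis_exists : c != 0 -> exists V : {fset R},
  c \notin V /\ Fp_basis p (annihilator p x y) (c |` V)%fset.
Proof.
move=> c0; have [L hL] := pxy_nilpotent_ring_finite.
pose free (B : {fset R}) := (forall b, b \in B -> annihilator p x y b) /\
  forall f : R -> 'F_p, \sum_(b <- B) b *+ f b = 0 ->
    forall b, b \in B -> f b = 0.
pose in_span (B : {fset R}) w :=
  exists f : R -> 'F_p, w = \sum_(b <- B) b *+ f b.
suff [B [cB [hB fB] sB]] : exists B : {fset R}, [/\ c \in B, free B &
    forall w, annihilator p x y w -> in_span B w].
  by exists (B `\ c)%fset; rewrite fsetD11; split=> //; rewrite fsetD1K.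
have sumU w (B : {fset R}) (f : R -> 'F_p) : w \notin B ->
    \sum_(b <- (w |` B)%fset) b *+ f b = w *+ f w + \sum_(b <- B) b *+ f b.
  by move=> wB; rewrite big_fsetU1.
have extend (B : {fset R}) w : free B -> annihilator p x y w ->
    ~ in_span B w ->
    w \notin B /\ free (w |` B)%fset.
  move=> [hB fB] hw nw; have wB : w \notin B.
    apply: contra_notN nw => wB; exists (fun b => (b == w)%:R).
    rewrite (bigD1_seq w) ?fset_uniq //= eqxx big1 => [|b /negPf ->].
      by rewrite mulrn_natF ?mulr1n ?addr0 // annihilator_mulrnp.
    by rewrite mulr0n.
  split=> //; split=> [b|f]; first by rewrite !inE => /orP[/eqP ->|/hB].
  rewrite sumU // => fwB.
  have fw0 : f w = 0.
    apply/eqP; apply: contra_notT nw => fw0.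
    (* A relation with f w nonzero can be solved for w, against the choice of w outside the span. *)
    exists (fun b => - f b / f w).
    have wp := annihilator_mulrnp hw.
    rewrite -[LHS]mulr1n -(mulrn_natF hp wp) -(divff fw0) (mulrnFM hp wp).
    move/eqP: fwB; rewrite addr_eq0 => /eqP ->; rewrite -sumrN -sumrMnl.
    apply: eq_big_seq => b /hB/annihilator_mulrnp bp.
    by rewrite (mulrnFM hp bp) (mulrnFN hp bp).
  move: fwB; rewrite fw0 mulr0n add0r => /fB hb b.
  by rewrite !inE => /orP[/eqP ->|/hb].
(* A free family is enlarged until it spans; k bounds the remaining steps, as B cannot have more
   elements than the ring. The start is the family of c alone, free because c is nonzero. *)
have step k (B : {fset R}) :
    (#|` [fset z in L]%fset | < k + #|` B|)%N -> c \in B -> free B ->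
    exists B : {fset R}, [/\ c \in B, free B &
      forall w, annihilator p x y w -> in_span B w].
  elim: k B => [|k IH] B hk cB fB.
    have : (#|` B| <= #|` [fset z in L]%fset|)%N.
      by apply: fsubset_leq_card; apply/fsubsetP => b _; rewrite inE.
    by rewrite leqNgt hk.
  have [h|/existsNP[w /not_implyP[hw nw]]] :=
      pselect (forall w, annihilator p x y w -> in_span B w).
    by exists B.
  have [wB fwB] := extend B w fB hw nw.
  apply: (IH (w |` B)%fset) => //; last by rewrite !inE cB orbT.
  by rewrite cardfsU1 wB addnA addn1.
apply: (step #|` [fset z in L]%fset | [fset c]%fset).
- by rewrite cardfs1 addn1.
- exact: fset11.
- split=> [b|f]; first by rewrite inE => /eqP ->; exact: annihilator_bracket.
  rewrite big_seq_fset1 => fc b; rewrite inE => /eqP ->.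
  exact: (mulrnF_inj hp bracket_mulrnp).
Qed.

(** If every v equalled m_v c, the basis would span only F_p c. A nonzero generator makes the kernel
    grow strictly at the next stage. *)
Lemma basis_generator_neq0 (V : {fset R}) (m : R -> 'F_p) :
  annihilator p x y <> Fp_multiples p c ->
  Fp_basis p (annihilator p x y) (c |` V)%fset ->
  exists2 v, v \in V & v != c *+ m v.
Proof.
move=> hann [_ _ span]; apply: contrapT => no_v; apply: hann.
apply/seteqP; split=> w; last exact: Fp_multiples_annihilator.
have cp := bracket_mulrnp.
move=> /span[f ->]; rewrite big_seq; apply: big_ind; first by exists 0.
  move=> _ _ [k _ <-] [l _ <-]; exists (k + l) => //.
  exact: mulrnFD.
move=> b; rewrite !inE => /orP[/eqP ->|bV]; first by exists (f c).
have bm : b = c *+ m b by apply: contrapT => /eqP bc; apply: no_v; exists b.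
by exists (m b * f b); rewrite // (mulrnFM hp cp) -bm.
Qed.

Section ChoiceIdeal.
Variables (V : {fset R}) (m : R -> 'F_p).
Hypothesis basisV : Fp_basis p (annihilator p x y) (c |` V)%fset.

Let e (v : R) : R := v - c *+ m v.

Lemma annihilator_generator v : v \in V -> annihilator p x y (e v).
Proof.
have [hV _ _] := basisV => vV; apply: annihilatorD.
  by apply: hV; rewrite !inE vV orbT.
by rewrite pmulrn -mulrNz; exact/annihilator_mulrz/annihilator_bracket.
Qed.

(** The generators lie in the annihilator, where R acts through integers, so their integer span is
    already an ideal. *)
Lemma choice_ideal_combination r : r \in choice_ideal x y V m ->
  exists f : R -> int, r = \sum_(v <- V) e v *~ f v.
Proof.
pose W := [set \sum_(v <- V) e v *~ f v | f in [set: R -> int]].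
have Wann s : W s -> annihilator p x y s.
  case=> f _ <-; rewrite big_seq; apply: big_ind.
  - by move=> u _; rewrite mul0r mulr0.
  - exact: annihilatorD.
  - by move=> v vV; exact/annihilator_mulrz/annihilator_generator.
have WZ s (k : int) : W s -> W (s *~ k).
  case=> f _ <-; exists (fun v => f v * k) => //.
  by rewrite mulrz_suml; apply: eq_bigr => v _; rewrite mulrzA.
move=> hr; suff [f _ <-] : W r by exists f.
apply: gen_ideal_min hr; first split.
- by exists (fun=> 0) => //; apply: big1 => v _; rewrite mulr0z.
- move=> _ _ [f _ <-] [g _ <-]; exists (fun v => f v + g v) => //.
  by rewrite -big_split; apply: eq_bigr => v _; rewrite mulrzDr.
- move=> a s Ws; have [k ->] := annihilator_mulrl a (Wann s Ws); exact: WZ.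
- move=> a s Ws; have [k ->] := annihilator_mulrr a (Wann s Ws); exact: WZ.
move=> _ [v vV <-]; exists (fun u => (u == v)%:Z) => //.
rewrite (bigD1_seq v) ?fset_uniq //= eqxx mulr1z big1 ?addr0 // => u /negPf ->.
by rewrite mulr0z.
Qed.

Lemma bracket_notin_choice_ideal : c \notin V -> c \notin choice_ideal x y V m.
Proof.
move=> cV; apply/negP => /choice_ideal_combination[f cf].
have [hV freeV _] := basisV.
have vp v : v \in V -> v *+ p = 0.
  by move=> vV; apply/annihilator_mulrnp/hV; rewrite !inE vV orbT.
have cp := bracket_mulrnp.
pose fF v : 'F_p := (f v)%:~R.
have cE : c = \sum_(v <- V) v *+ fF v - c *+ (\sum_(v <- V) m v * fF v)%R.
  rewrite (mulrnF_sum hp cp) -sumrB {1}cf.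
  apply: eq_big_seq => v vV.
  rewrite (mulrz_intF hp (vp v vV)) (mulrnFM hp cp) (mulrz_intF hp).
    by rewrite mulrzBl.
  by rewrite mulrnAC cp mul0rn.
(* These are the coefficients of the relation obtained by moving c to the right of [cE]. Freeness
   kills those of V, which leaves -1 as the coefficient of c. *)
pose F v : 'F_p := if v == c then - (1 + \sum_(v <- V) m v * fF v) else fF v.
have sumF : \sum_(b <- (c |` V)%fset) b *+ F b = 0.
  rewrite big_fsetU1 //= {1}/F eqxx (mulrnFN hp cp) (mulrnFD hp cp).
  rewrite (eq_big_seq (fun v => v *+ fF v)) => [|v vV]; last first.
    by rewrite /F; case: eqP => // vc; rewrite -vc vV in cV.
  by rewrite (mulrn_natF hp cp 1) mulr1n {1}cE subrK addNr.
have F0 v : v \in V -> fF v = 0.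
  move=> vV; have := freeV F sumF v; rewrite !inE vV orbT /F => /(_ isT).
  by case: eqP => // vc; rewrite -vc vV in cV.
have := freeV F sumF c; rewrite !inE eqxx /F eqxx => /(_ isT)/eqP.
by rewrite big_seq big1 => [|v /F0 ->]; rewrite ?mulr0 // addr0 oppr_eq0 oner_eq0.
Qed.

End ChoiceIdeal.

End PxyNilpotent.

(** * The first isomorphism theorem and strict counting *)

Lemma same_quotient_of_kernel (A S : pzRingType) (J : ideal A)
    (f : {rmorphism A -> S}) :
  (forall s, exists a, f a = s) -> (forall a, f a = 0 <-> a \in J) ->
  same_quotient (quot_proj J) f.
Proof.
move=> fsurj fker.
pose h (u : quot_ring J) : S := f (repr (u : Quotient.quot J)).
have hE a : h (quot_proj J a) = f a.
  apply/eqP; rewrite -subr_eq0 -rmorphB; apply/eqP/fker/quot_proj_eqP.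
  exact: quot_projK.
have hB : zmod_morphism h.
  move=> u v; have [a <-] := quot_proj_surj u; have [b <-] := quot_proj_surj v.
  by rewrite -rmorphB !hE rmorphB.
have hM : monoid_morphism h.
  split=> [|u v]; first by rewrite -(rmorph1 (quot_proj J)) hE rmorph1.
  have [a <-] := quot_proj_surj u; have [b <-] := quot_proj_surj v.
  by rewrite -rmorphM !hE rmorphM.
pose hAdd := GRing.isZmodMorphism.Build _ _ h hB.
pose hMul := GRing.isMonoidMorphism.Build _ _ h hM.
pose H : {rmorphism quot_ring J -> S} := HB.pack h hAdd hMul.
exists H; split; last exact: hE.
have hinj : injective h.
  move=> u v; have [a <-] := quot_proj_surj u; have [b <-] := quot_proj_surj v.
  rewrite !hE => /eqP; rewrite -subr_eq0 -rmorphB => /eqP/fker.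
  by move/quot_proj_eqP.
have hsurj s : exists u, h u = s.
  by have [a <-] := fsurj s; exists (quot_proj J a).
have [g gK] := choice hsurj.
by exists g => [u|//]; apply: hinj; exact: gK.
Qed.

Lemma count_lt (T : eqType) (a : T) (P Q : pred T) (L : seq T) :
  subpred P Q -> a \in L -> Q a -> ~~ P a -> (count P L < count Q L)%N.
Proof.
move=> PQ aL Qa Pa; have /permP h := perm_to_rem aL.
by rewrite !h /= Qa (negPf Pa) add0n add1n ltnS sub_count.
Qed.

(** * Outputs of the procedure are minimal noncommutative *)

Section Procedure.
Variables (p n : nat) (A : pzRingType) (x y : A).
Hypotheses (hp : prime p) (hA : pxy_nilpotent_ring p n x y).

Lemma procedure_stage_surj i (R : pzRingType) (phi : {rmorphism A -> R}) :
  procedure_stage p x y i phi -> forall r, exists a, phi a = r.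
Proof.
elim=> [r|{}i {}R {}phi V m _ IH _ _ _ r]; first by exists r.
have [s <-] := quot_proj_surj r; have [a <-] := IH s.
by exists a.
Qed.

Lemma procedure_stage_nilpotent_ring i (R : pzRingType)
    (phi : {rmorphism A -> R}) :
  procedure_stage p x y i phi -> pxy_nilpotent_ring p n (phi x) (phi y).
Proof. by move=> /procedure_stage_surj phi_surj; exact: pxy_nilpotent_map. Qed.

(** If the next stage were zero, the ideal divided out would contain 1 and hence c. *)
Lemma procedure_stage_nontrivial i (R : pzRingType) (phi : {rmorphism A -> R}) :
  1 != 0 :> A -> procedure_stage p x y i phi -> 1 != 0 :> R.
Proof.
move=> A1; elim=> // {}i {}R {}phi V m hphi R1 _ cV hV.
have hR := procedure_stage_nilpotent_ring hphi.
apply: contraNneq (bracket_notin_choice_ideal hp hR m hV cV) => h1.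
rewrite -[bracket _ _]mulr1; apply: ideal_mull.
by apply/quot_proj_eq0; rewrite rmorph1.
Qed.

Lemma same_quotient_annihilator (R S : pzRingType) (phi : {rmorphism A -> R})
    (psi : {rmorphism A -> S}) :
  (forall r, exists a, phi a = r) -> same_quotient phi psi ->
  annihilator p (psi x) (psi y) = Fp_multiples p (bracket (psi x) (psi y)) ->
  annihilator p (phi x) (phi y) = Fp_multiples p (bracket (phi x) (phi y)).
Proof.
move=> phi_surj [h [[g hK gK] hE]] hann.
have hsurj s : exists r, h r = s by exists (g s).
have hR := pxy_nilpotent_map phi_surj hA.
apply/seteqP; split=> r; last exact: (Fp_multiples_annihilator hR).
move=> hr; have : annihilator p (psi x) (psi y) (h r).
  rewrite -!hE => s /(pxy_ideal_lift hsurj)[u hu <-].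
  by have [e e'] := hr u hu; rewrite -!rmorphM e e' rmorph0.
rewrite hann => -[k _ hk]; exists k => //; apply: (can_inj hK).
by rewrite -hk rmorphMn map_bracket !hE.
Qed.

Lemma output_minimal_noncommutative N (S : pzRingType)
    (psi : {rmorphism A -> S}) (J : ideal A) :
  1 != 0 :> A -> procedure_output p x y N psi ->
  same_quotient (quot_proj J) psi -> minimal_noncommutative (quot_ring J).
Proof.
move=> A1 [hpsi hann] hJ.
have S1 := procedure_stage_nontrivial A1 hpsi.
have hQ := pxy_nilpotent_map (quot_proj_surj (J := J)) hA.
apply: (annihilator_minimal_noncommutative hp hQ).
  have [h [_ hE]] := hJ; apply: contra_neq S1 => h1.
  by rewrite -(rmorph1 h) h1 rmorph0.
exact: (same_quotient_annihilator (quot_proj_surj (J := J)) hJ).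
Qed.

(** * Minimal noncommutative quotients are outputs *)

Section MinimalQuotient.
Variable J : ideal A.
Hypothesis hJ : minimal_noncommutative (quot_ring J).

(* The image in A/J of v in V lies in the annihilator, hence is a multiple of the
   image of the bracket: this is how the scalars are chosen. *)
Lemma stage_kernel_choice (R : pzRingType) (phi : {rmorphism A -> R})
    (V : {fset R}) :
  (forall r, exists a, phi a = r) -> (forall a, phi a = 0 -> a \in J) ->
  (forall v, v \in V -> annihilator p (phi x) (phi y) v) ->
  exists m : R -> 'F_p, forall a,
    phi a \in choice_ideal (phi x) (phi y) V m -> a \in J.
Proof.
move=> phi_surj kerJ hV.
have hQ := pxy_nilpotent_map (quot_proj_surj (J := J)) hA.
have hann := minimal_noncommutative_annihilator hp hQ hJ.
have /choice[m hm] : forall v, exists k : 'F_p, v \in V ->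
    exists2 b, b \in J & phi b = v - bracket (phi x) (phi y) *+ k.
  (* [choice] needs a total function, so the scalar is 0 by default outside V. *)
  move=> v; have [vV|] := boolP (v \in V); last by exists 0.
  have [a av] := phi_surj v.
  have : annihilator p (quot_proj J x) (quot_proj J y) (quot_proj J a).
    move=> u /(pxy_ideal_lift (quot_proj_surj (J := J)))[w hw <-].
    have [e e'] := hV v vV _ (pxy_ideal_map phi hw).
    by rewrite -!rmorphM; split; apply/quot_proj_eq0/kerJ; rewrite rmorphM av.
  rewrite hann => -[k _ hk]; exists k => _.
  exists (a - bracket x y *+ k); last first.
    by rewrite rmorphB rmorphMn map_bracket av.
  by apply/quot_proj_eq0; rewrite rmorphB rmorphMn map_bracket hk subrr.
exists m => a ha.
(* The image of J is an ideal containing every generator; as the kernel of phi is inside J,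
   membership of phi a in it pulls back to a in J. *)
have : (phi @` [set` J]) (phi a).
  apply: gen_ideal_min ha; first exact/image_is_ideal/ideal_is_ideal.
  by move=> _ [v vV <-]; have [b bJ bv] := hm v vV; exists b.
case=> b bJ ba; rewrite -(subrK b a); apply: rpredD => //.
by apply: kerJ; rewrite rmorphB ba subrr.
Qed.

Lemma minimal_noncommutative_output :
  exists (N : nat) (S : pzRingType) (phi : {rmorphism A -> S}),
    procedure_output p x y N phi /\ same_quotient (quot_proj J) phi.
Proof.
have [L hL] := pxy_nilpotent_ring_finite hp hA.
(* Induction on a bound k for the number of listed elements of A that are nonzero in R. *)
suff step (k i : nat) (R : pzRingType) (phi : {rmorphism A -> R}) :
    (count (fun a => phi a != 0%R) L < k)%N ->
    procedure_stage p x y i phi -> (forall a, phi a = 0 -> a \in J) ->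
    exists (N : nat) (S : pzRingType) (psi : {rmorphism A -> S}),
    procedure_output p x y N psi /\ same_quotient (quot_proj J) psi.
  apply: (step _ 0%N A idfun (ltnSn _)); first exact: Stage0.
  by move=> a /= ->; exact: rpred0.
elim: k i R phi => [//|k IH] i R phi hk hphi kerJ.
have phi_surj := procedure_stage_surj hphi.
have hR := procedure_stage_nilpotent_ring hphi.
have cJ : bracket x y \notin J.
  have [nc _ _] := hJ; apply: contra_notN nc => cJ.
  have hQ := pxy_nilpotent_map (quot_proj_surj (J := J)) hA.
  apply: (commutative_bracket0 hQ).
  by rewrite -map_bracket; apply/quot_proj_eq0.
have [hann|hann] := pselect (annihilator p (phi x) (phi y) =
    Fp_multiples p (bracket (phi x) (phi y))).
  exists i, R, phi; split=> //; apply: same_quotient_of_kernel => // a.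
  (* If phi a were nonzero, the image of J would be a nonzero ideal, hence contain the bracket, and
     c would lie in J. *)
  split=> [/kerJ //|aJ]; apply: contrapT => /eqP a0.
  have : (phi @` [set` J]) (bracket (phi x) (phi y)).
    apply: (bracket_in_ideal hp hR hann).
      exact/image_is_ideal/ideal_is_ideal.
    by exists (phi a) => //; exists a.
  case=> b bJ; rewrite -map_bracket => bc; move/negP: cJ; apply.
  rewrite -(subrK b (bracket x y)); apply: rpredD => //.
  by apply: kerJ; rewrite rmorphB bc subrr.
have c0 : bracket (phi x) (phi y) != 0.
  by apply: contraNneq cJ; rewrite -map_bracket => /kerJ.
have [V [cV hV]] := ann_basis_exists hp hR c0.
have [hVann _ _] := hV.
have [|m hm] := stage_kernel_choice phi_surj kerJ (V := V).
  by move=> v vV; apply: hVann; rewrite !inE vV orbT.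
have hS := StageS m hphi hann cV hV.
apply: IH hS _ => [|a /= /quot_proj_eq0]; last exact: hm.
rewrite -ltnS; apply: leq_ltn_trans hk.
have [v vV vm] := basis_generator_neq0 hp hR m hann hV.
(* A lift of a nonzero generator survives in R and dies at the next stage, so the count drops. *)
have [a av] := phi_surj (v - bracket (phi x) (phi y) *+ m v).
apply: (@count_lt _ a) => [b /=|//|/=|/=].
- by apply: contra_neq => b0; rewrite b0 raddf0.
- by rewrite av subr_eq0.
- rewrite negbK; apply/eqP/quot_proj_eq0; rewrite av.
  by apply: mem_gen_ideal; exists v.
Qed.

End MinimalQuotient.
End Procedure.

(** * The ring A *)

Section RingA.
Variables p n : nat.

(** Every element is an integer combination of words, and every word is a product of letters. *)
Lemma Zxy_generated : generated_by Zx Zy.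
Proof.
move=> P P1 PB PM Px Py r.
have P0 : P 0 by rewrite -(subrr 1); exact: PB.
have [_ PD PZ] := subgroup_closed P0 PB.
have Pword (s : seq 'I_2) : P << FMonom s >>.
  elim: s => [|i s IH]; first by rewrite -fmoneE; exact: P1.
  have -> : << FMonom (i :: s) >> = << fmu i >> * << FMonom s >> :> Zxy.
    rewrite malgM_def fgmulUU mulr1; congr << _ *g _ >>.
    by rewrite fmuE /= [in RHS]/mmul /= fmmulE.
  apply: (PM _ _ _ IH); have [->|->] : i = 0 \/ i = 1.
  - by case: i => -[|[|//]] hi; [left | right]; exact/val_inj.
  - exact: Px.
  - exact: Py.
have UE (z : int) k : << z *g k >> = << k >> *~ z :> Zxy.
  by rewrite -{1}(intz z) raddfMz.
rewrite (monalgE r); apply: (big_ind P P0 PD) => -[s] _.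
rewrite UE; apply: PZ; exact: Pword.
Qed.

Lemma projA_surj a : exists r, projA p n r = a.
Proof. exact: quot_proj_surj. Qed.

Lemma projA_eq0 r : projA p n r = 0 <-> relA p n r.
Proof.
by split=> [/quot_proj_eq0/asboolP|hr] //; apply/quot_proj_eq0/asboolP.
Qed.

(** Each relation is lifted to the free ring and placed in its summand of [relA], with 0 in the
    others and 1 as the missing outer factor. *)
Lemma ringA_nilpotent : pxy_nilpotent_ring p n (xA p n) (yA p n).
Proof.
split.
- move=> u /(pxy_ideal_lift projA_surj)[v hv <-].
  rewrite -map_bracket -rmorphM; apply/projA_eq0.
  exists (v * bracket Zx Zy), 0; rewrite addr0; split => //; last first.
    by have [] := pow_span_is_ideal n (pxy_is_ideal p Zx Zy).
  exists (v * bracket Zx Zy), 0; rewrite addr0; split => //; last first.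
    by exists [::] => //; rewrite big_nil.
  exists [:: (v * bracket Zx Zy, 1)]; last by rewrite big_seq1 mulr1.
  move=> w; rewrite inE => /eqP -> /=; split=> //.
  exists [:: (v, bracket Zx Zy)]; last by rewrite big_seq1.
  by move=> z; rewrite inE => /eqP ->.
- move=> u /(pxy_ideal_lift projA_surj)[v hv <-].
  rewrite -map_bracket -rmorphM; apply/projA_eq0.
  exists (bracket Zx Zy * v), 0; rewrite addr0; split => //; last first.
    by have [] := pow_span_is_ideal n (pxy_is_ideal p Zx Zy).
  exists 0, (bracket Zx Zy * v); rewrite add0r; split => //.
    by exists [::] => //; rewrite big_nil.
  exists [:: (bracket Zx Zy, v)]; last by rewrite big_seq1.
  move=> w; rewrite inE => /eqP -> /=; split=> //.
  exists [:: (1, bracket Zx Zy)]; last by rewrite big_seq1 mul1r.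
  by move=> z; rewrite inE => /eqP ->.
- move=> u /(pow_span_lift projA_surj (X := [set` pxy_ideal p Zx Zy])) [|v hv <-].
    exact: (pxy_ideal_lift projA_surj).
  apply/projA_eq0; exists 0, v; rewrite add0r; split => //.
  by exists 0, 0; rewrite addr0; split => //; exists [::]; rewrite ?big_nil.
- exact: (generated_by_map projA_surj Zxy_generated).
Qed.

(** The constant coefficient is a ring morphism to Z that sends p, x, y to p, 0, 0. *)
Lemma pxy_ideal_constant_coeff (r : Zxy) :
  r \in pxy_ideal p Zx Zy -> (p%:Z %| mcoeff (fmone 'I_2) r)%Z.
Proof.
apply: (pxy_ideal_min (X := [set r : Zxy | (p%:Z %| mcoeff (fmone 'I_2) r)%Z])).
- split=> [|u v|a u|a u] /=.
  + by rewrite mcoeff0.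
  + by rewrite mcoeffD; exact: rpredD.
  + by rewrite rmorphM /= => h; apply: dvdz_mull.
  + by rewrite rmorphM /= => h; apply: dvdz_mulr.
- by rewrite /= mcoeffMn mcoeff1 eqxx -mulrnA mul1n natz dvdzz.
- by rewrite /= mcoeffU1 [_ == _]fm1_eq1.
- by rewrite /= mcoeffU1 [_ == _]fm1_eq1.
Qed.

(** All relations lie in M, because c does and n is positive, whereas the constant coefficient of 1
    is not divisible by p. *)
Lemma ringA_nontrivial : prime p -> (0 < n)%N -> 1 != 0 :> ringA p n.
Proof.
move=> hp n0; apply/eqP => /esym h1.
have hM := pxy_is_ideal p Zx Zy.
have : relA p n 1.
  by apply/projA_eq0; rewrite rmorph1.
suff sub : relA p n `<=` [set` pxy_ideal p Zx Zy].
  move=> /sub/pxy_ideal_constant_coeff; rewrite mcoeff1 eqxx dvdz1 /=.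
  by move=> /eqP p1; rewrite p1 in hp.
have [M0 MD ML MR] := hM.
have Mc : bracket Zx Zy \in pxy_ideal p Zx Zy.
  by apply: rpredB; apply: ideal_mulr; [exact: pxy_x | exact: pxy_y].
move=> _ [_ [b [[u [v [hu hv ->]]] hb ->]]]; apply: (MD); first apply: MD.
- apply: (mul_span_min hM) hu => a1 a2 ha _; apply: MR.
  by apply: (mul_span_min hM) ha => d _ _ ->; exact: ML.
- by apply: (mul_span_min hM) hv => a1 a2 _ ha; exact: ML.
- by move: n0 hb; case: n => // k _; exact: mul_span_subl.
Qed.

End RingA.

Theorem theorem3p1 (p n : nat) (hp : prime p) (hn : (3 <= n)%N)
    (J : ideal (ringA p n)) :
  minimal_noncommutative (quot_ring J) <->
  exists (N : nat) (S : pzRingType) (phi : {rmorphism ringA p n -> S}),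
    procedure_output p (xA p n) (yA p n) N phi /\
    same_quotient (quot_proj J) phi.
Proof.
have hA := ringA_nilpotent p n.
have A1 : 1 != 0 :> ringA p n.
  by apply: ringA_nontrivial => //; exact: leq_trans hn.
split=> [hJ|[N [S [phi [hphi hJ]]]]].
  exact: (minimal_noncommutative_output hp hA hJ).
exact: (output_minimal_noncommutative hp hA A1 hphi hJ).
Qed.
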